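(* Let $A,B,C$ be real matrices of sizes $n\times n$, $n\times r$, $r\times n$ with $\operatorname{rank}B=r$, $(A,B)$ controllable with controllability index $\nu\ge2$, and $\det(CB)\ne0$. Then the system zeros of $\dot x=Ax+Bu$, $y=Cx$ are the eigenvalues of the $(n-r)\times(n-r)$ matrix $\begin{bmatrix} E \\ \hat T \end{bmatrix}$, where $$E=\begin{bmatrix} O & E_{1,2} & O & \cdots & O \\ O & O & E_{2,3} & \cdots & O \\ \vdots & & & \ddots & \vdots \\ O & O & O & \cdots & E_{\nu-2,\nu-1} \end{bmatrix},\quad E_{i,i+1}=[O,I_{l_i}]\ \text{of size } l_i\times l_{i+1},$$ has column blocks of sizes $l_1,\dots,l_{\nu-1}$, and the $l_{\nu-1}\times(n-r)$ matrix $\hat T$ is $$\hat T=\begin{cases} -C_\nu^{-1}[C_1,C_2,\dots,C_{\nu-1}], & l_{\nu-1}=r, \\ -[O,I_{l_{\nu-1}}]\,C_\nu^{-1}[C_1,C_2,\dots,C_{\nu-1}], & l_{\nu-1}<r. \end{cases}$$ Here the integers $l_i$ and the matrices $C_i$ come from the Yokoyama canonical form as in the context.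
   Context: Controllability index: the smallest $\nu$ with $\operatorname{rank}[B,AB,\dots,A^{\nu-1}B]=\operatorname{rank}[B,\dots,A^{n-1}B]$. Integers $l_1\le\cdots\le l_\nu=r$ are defined by $l_\nu=\operatorname{rank}B$ and $l_{\nu-k}=\operatorname{rank}[B,\dots,A^{k}B]-\operatorname{rank}[B,\dots,A^{k-1}B]$, $k=1,\dots,\nu-1$; then $l_1+\cdots+l_\nu=n$. Yokoyama canonical form: there are a nonsingular $n\times n$ matrix $N$ and an $r\times r$ permutation matrix $M$ such that $$NAN^{-1}=\begin{bmatrix} O & E_{1,2} & O & \cdots & O \\ O & O & E_{2,3} & \cdots & O \\ \vdots & & & \ddots & \vdots \\ O & O & O & \cdots & E_{\nu-1,\nu} \\ F_{\nu 1} & F_{\nu 2} & F_{\nu 3} & \cdots & F_{\nu\nu} \end{bmatrix},\qquad NBM=\begin{bmatrix} O \\ G_\nu \end{bmatrix},$$ with block sizes $l_1,\dots,l_\nu$, $E_{i,i+1}=[O,I_{l_i}]$ of size $l_i\times l_{i+1}$, and $G_\nu$ an $r\times r$ lower triangular matrix with unit diagonal. Fix such $N,M$ and partition $CN^{-1}=[C_1,\dots,C_\nu]$ with $C_i$ of size $r\times l_i$. (When $\det(CB)\neq0$ the matrix $C_\nu$ is invertible.) For $\nu=2$ the block $E$ is empty. In this square case the system zeros are the zeros of $\det\begin{bmatrix} sI_n-A & -B \\ C & O \end{bmatrix}$, which is not identically zero when $\det(CB)\ne0$. *)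

(* Defs.v *)
From HB Require Import structures.
From mathcomp Require Import all_boot all_order all_algebra.
From mathcomp Require Import reals complex.

Set Implicit Arguments.
Unset Strict Implicit.
Unset Printing Implicit Defensive.

Import GRing.Theory.
Local Open Scope ring_scope.

Section Controllability.
Variables (F : fieldType) (n r : nat).
Implicit Types (A : 'M[F]_n) (B : 'M[F]_(n, r)).

(* [B, A B, ..., A^(k-1) B]; for k = 0 this matrix has no column and rank 0 *)
Definition ctrb_mx A B (k : nat) : 'M[F]_(n, \sum_(i < k) r) :=
  \mxrow_(i < k) (A ^+ i *m B).

Definition ctrb_rank A B (k : nat) : nat := \rank (ctrb_mx A B k).

Definition controllable A B : Prop := ctrb_rank A B n = n.

Lemma ctrl_index_exists A B :
  exists k, ctrb_rank A B k == ctrb_rank A B n.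
Proof. by exists n. Qed.

Definition ctrl_index A B : nat := ex_minn (ctrl_index_exists A B).

(* The integers l_i, 1 <= i <= nu; with k = nu - i the second branch is
   rank [B, ..., A^k B] - rank [B, ..., A^(k-1) B]. *)
Definition block_size A B (nu i : nat) : nat :=
  if i == nu then \rank B
  else (ctrb_rank A B (nu - i).+1 - ctrb_rank A B (nu - i))%N.

End Controllability.

(* The sequence l_1, ..., l_nu is encoded by l : nat -> nat, of which only
   the values at 1, ..., nu matter; block number i : 'I_nu has size l i.+1. *)
Record block_dims (n r nu : nat) (l : nat -> nat) : Prop := BlockDims {
  block_dims_ge2 : (2 <= nu)%N;
  block_dims_sum : (\sum_(i < nu) l i.+1)%N = n;
  block_dims_last : l nu = r }.

Section BlockDims.
Variables (n r nu : nat) (l : nat -> nat).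
Hypothesis d : block_dims n r nu l.

Lemma block_dims_pred_lt : (nu.-1 < nu)%N.
Proof. by case: d => h _ _; rewrite prednK // ltnW. Qed.

Lemma block_dims_lastS : l nu.-1.+1 = r.
Proof. by case: d => h _ <-; rewrite prednK // ltnW. Qed.

Lemma block_dims_splitr : (\sum_(i < nu.-1) l i.+1 + r)%N = n.
Proof.
by case: d; case: (nu) => [|k] //= _ <- <-; rewrite big_ord_recr.
Qed.

Lemma block_dims_init : (\sum_(i < nu.-1) l i.+1)%N = (n - r)%N.
Proof. by rewrite -block_dims_splitr addnK. Qed.

Lemma block_dims_splitl : (\sum_(i < nu.-2) l i.+1 + l nu.-1)%N = (n - r)%N.
Proof.
rewrite -block_dims_init; case: d.
by case: (nu) => [|[|k]] //= _ _ _; rewrite big_ord_recr.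
Qed.

End BlockDims.

Section Yokoyama.
Variables (F : fieldType) (n r nu : nat) (l : nat -> nat).
Hypothesis d : block_dims n r nu l.

(* [O, I_p] of size p x q (for p <= q): the entry (a, b) is 1 iff
   b = (q - p) + a. *)
Definition tail_mx (p q : nat) : 'M[F]_(p, q) :=
  \matrix_(a < p, b < q) ((b + p)%N == (a + q)%N)%:R.

(* p block rows and q block columns, with E_{i,i+1} = [O, I_{l_i}] just above
   the block diagonal *)
Definition shift_mx (p q : nat) :
    'M[F]_(\sum_(i < p) l i.+1, \sum_(j < q) l j.+1) :=
  \mxblock_(i < p, j < q)
    (if j == i.+1 :> nat then tail_mx (l i.+1) (l j.+1) else 0).

(* Fnu is the last block row [F_{nu 1}, ..., F_{nu nu}], of height l_nu = r. *)
Definition yokoyama_form (A : 'M[F]_n) (B : 'M[F]_(n, r))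
    (N : 'M[F]_n) (M : 'M[F]_r) : Prop :=
  [/\ N \in unitmx,
      is_perm_mx M,
      exists Fnu : 'M[F]_(r, \sum_(j < nu) l j.+1),
        N *m A *m invmx N =
          castmx (block_dims_splitr d, block_dims_sum d)
                 (col_mx (shift_mx nu.-1 nu) Fnu)
    & exists G : 'M[F]_r,
        [/\ is_trig_mx G, forall i, G i i = 1
          & N *m B *m M =
              castmx (block_dims_splitr d, erefl r) (col_mx 0 G)]].

Variables (C : 'M[F]_(r, n)) (N : 'M[F]_n).

(* C N^-1 = [C_1, ..., C_nu]. Ordinals start at 0, so output_block j is
   C_{j+1}; output_init is [C_1, ..., C_{nu-1}] and output_last is C_nu, seen
   as an r x r matrix. *)
Definition output_mx : 'M[F]_(r, \sum_(j < nu) l j.+1) :=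
  castmx (erefl r, esym (block_dims_sum d)) (C *m invmx N).

Definition output_block (j : 'I_nu) : 'M[F]_(r, l j.+1) :=
  submxrow output_mx j.

Definition output_init : 'M[F]_(r, \sum_(j < nu.-1) l j.+1) :=
  \mxrow_(j < nu.-1) output_block (widen_ord (leq_pred nu) j).

Definition output_last : 'M[F]_r :=
  castmx (erefl r, block_dims_lastS d)
         (output_block (Ordinal (block_dims_pred_lt d))).

(* In the situation of block_size_dims below one has l_{nu-1} <= r, so the
   second branch is the case l_{nu-1} < r. *)
Definition That_mx : 'M[F]_(l nu.-1, \sum_(j < nu.-1) l j.+1) :=
  match l nu.-1 =P r with
  | ReflectT e =>
      castmx (esym e, erefl) (- (invmx output_last *m output_init))
  | ReflectF _ =>
      - (tail_mx (l nu.-1) r *m invmx output_last *m output_init)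
  end.

Definition zeros_mx : 'M[F]_(n - r) :=
  castmx (block_dims_splitl d, block_dims_init d)
         (col_mx (shift_mx nu.-2 nu.-1) That_mx).

End Yokoyama.

Section BlockSizeDims.
Variables (F : fieldType) (n r : nat) (A : 'M[F]_n) (B : 'M[F]_(n, r)).

Lemma ctrb_rank_sum k :
  ctrb_rank A B k = \rank (\sum_(i < k) <<(A ^+ i *m B)^T>>)%MS.
Proof.
by rewrite /ctrb_rank -mxrank_tr /ctrb_mx tr_mxrow eqmx_col.
Qed.

Lemma ctrb_rank0 : ctrb_rank A B 0 = 0%N.
Proof. by rewrite ctrb_rank_sum big_ord0 mxrank0. Qed.

Lemma ctrb_rank1 : ctrb_rank A B 1 = \rank B.
Proof.
rewrite ctrb_rank_sum big_ord_recl big_ord0 addsmx0 genmxE.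
by rewrite expr0 mul1mx mxrank_tr.
Qed.

Lemma ctrb_rank_homo k : (ctrb_rank A B k <= ctrb_rank A B k.+1)%N.
Proof.
by rewrite !ctrb_rank_sum mxrankS // big_ord_recr /= addsmxSl.
Qed.

Lemma block_sizeE nu i : (0 < nu)%N -> (i < nu)%N ->
  block_size A B nu (nu - i) =
    (ctrb_rank A B i.+1 - ctrb_rank A B i)%N.
Proof.
move=> nu_gt0 lt_i; rewrite /block_size.
case: eqP => [e | _]; last by rewrite subKn // ltnW.
have -> : i = 0%N by move: (subKn (ltnW lt_i)); rewrite e subnn.
by rewrite ctrb_rank0 ctrb_rank1 subn0.
Qed.

Lemma block_size_dims nu :
  \rank B = r -> controllable A B -> ctrl_index A B = nu -> (2 <= nu)%N ->
  block_dims n r nu (block_size A B nu).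
Proof.
move=> rB ctrAB idx nu_ge2; have nu_gt0 : (0 < nu)%N by apply: ltnW.
split=> //; last by rewrite /block_size eqxx.
have rk : ctrb_rank A B nu = n.
  by move: idx; rewrite /ctrl_index; case: ex_minnP => k /eqP e _ <-; rewrite e.
rewrite (reindex_inj rev_ord_inj) /=.
under eq_bigr => i _ do rewrite subnSK // block_sizeE //.
rewrite -(big_mkord predT (fun i => ctrb_rank A B i.+1 - ctrb_rank A B i)%N).
rewrite telescope_sumn ?ctrb_rank0 ?subn0 // => i j.
exact: (homo_leq (@leqnn) leq_trans ctrb_rank_homo).
Qed.

End BlockSizeDims.

Section SystemZeros.
Variables (R : realType) (n r : nat).

(* det [s I - A, -B; C, O] as a polynomial in s *)
Definition system_poly (A : 'M[R]_n) (B : 'M[R]_(n, r)) (C : 'M[R]_(r, n)) :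
    {poly R} :=
  \det (block_mx ('X%:M - map_mx polyC A) (- map_mx polyC B)
                 (map_mx polyC C) 0).

Definition system_polyC A B C : {poly complex R} :=
  map_poly (real_complex R) (system_poly A B C).

Definition system_zero A B C (z : complex R) : Prop :=
  root (system_polyC A B C) z.

End SystemZeros.

(* Main.v *)
(* Multiplying the system matrix by diag(N, 1) on the left and by
   diag(N^-1, M) on the right puts (A, B, C) in Yokoyama form at the cost of the
   constant factor det M. Then B is [0; G] with G invertible and C N^-1 is
   [Ci, Cl] with Cl invertible because Cl G = C B M, so both blocks can be
   eliminated, which leaves, up to a nonzero constant, the characteristic
   polynomial of S1 - S2 Cl^-1 Ci, where [S1, S2] consists of the upper rows of
   N A N^-1. As S2 vanishes above its last block row [O, I], and S1 vanishes
   there, this matrix is [E; That]. *)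
Require Import Defs.
From mathcomp Require Import all_boot all_order all_algebra.
From mathcomp Require Import reals complex.
Import GRing.Theory.
Local Open Scope ring_scope.

(** The offset of block [j] sums only the sizes of the earlier blocks, so appending a block leaves
    it unchanged. *)
Lemma Rank_widen (k : nat) (q : nat -> nat)
    (e : (\sum_(j < k) q j + q k = \sum_(j < k.+1) q j)%N)
    (j : 'I_k) (b : 'I_(q j)) :
  cast_ord e (lshift (q k) (tagnat.Rank (p_ := fun j : 'I_k => q j) j b)) =
  tagnat.Rank (p_ := fun j : 'I_k.+1 => q j) (widen_ord (leqnSn k) j) b.
Proof.
apply: ord_inj.
transitivity (tagnat.Rank (p_ := fun j : 'I_k => q j) j b : nat) => //.
rewrite !tagnat.RankEsum; congr (_ + _)%N.
rewrite [RHS]big_mkcond big_ord_recr /= ltnNge (ltnW (ltn_ord j)) addn0.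
by rewrite [LHS]big_mkcond.
Qed.

Lemma Rank_max (k : nat) (q : nat -> nat)
    (e : (\sum_(j < k) q j + q k = \sum_(j < k.+1) q j)%N) (b : 'I_(q k)) :
  cast_ord e (rshift (\sum_(j < k) q j) b) =
  tagnat.Rank (p_ := fun j : 'I_k.+1 => q j) ord_max b.
Proof.
apply: ord_inj; rewrite tagnat.RankEsum; congr (_ + _)%N.
rewrite [RHS]big_mkcond big_ord_recr /= ltnn addn0.
by apply: eq_bigr => i _; rewrite ltn_ord.
Qed.

Lemma mxrowE_Rank {T : Type} (m k : nat) (q : 'I_k -> nat)
    (B : forall j : 'I_k, 'M[T]_(m, q j)) i j (b : 'I_(q j)) :
  (\mxrow_j B j) i (tagnat.Rank j b) = B j i b.
Proof. by move/matrixP/(_ i b): (mxrowK B j); rewrite mxE. Qed.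

Lemma mxrow_recr {T : Type} {m k : nat} (q : nat -> nat)
    (e : (\sum_(j < k.+1) q j = \sum_(j < k) q j + q k)%N)
    (B : forall j : 'I_k.+1, 'M[T]_(m, q j)) :
  castmx (erefl, e) (\mxrow_j B j) =
  row_mx (\mxrow_j B (widen_ord (leqnSn k) j)) (B ord_max).
Proof.
apply/matrixP => i j; rewrite castmxE cast_ord_id.
case: (split_ordP j) => {}j ->.
  rewrite row_mxEl -[j]tagnat.sig2K Rank_widen.
  by rewrite !mxrowE_Rank.
by rewrite row_mxEr Rank_max mxrowE_Rank.
Qed.

Lemma mxcol_recd {T : Type} {n k : nat} (q : nat -> nat)
    (e : (\sum_(j < k.+1) q j = \sum_(j < k) q j + q k)%N)
    (B : forall j : 'I_k.+1, 'M[T]_(q j, n)) :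
  castmx (e, erefl) (\mxcol_j B j) =
  col_mx (\mxcol_j B (widen_ord (leqnSn k) j)) (B ord_max).
Proof.
apply: trmx_inj; rewrite trmx_cast /= tr_mxcol mxrow_recr.
by rewrite tr_col_mx tr_mxcol.
Qed.

(** Blocks off [j = i + 1] are zero, so the last block row and the last block column keep only the
    block they share. *)
Lemma shift_mx_recr (F : fieldType) (l : nat -> nat) (k : nat)
    (er : (\sum_(i < k.+1) l i.+1 = \sum_(i < k) l i.+1 + l k.+1)%N)
    (ec : (\sum_(j < k.+2) l j.+1 = \sum_(j < k.+1) l j.+1 + l k.+2)%N) :
  castmx (er, ec) (shift_mx F l k.+1 k.+2) =
  block_mx (shift_mx F l k k.+1) 0 0 (tail_mx F (l k.+1) (l k.+2)).
Proof.
(* The cast is factored into columns first, rows second, so that each index can be split on its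
   own. *)
rewrite (eq_castmx _ (etrans erefl er, etrans ec erefl)) -castmx_comp.
rewrite /shift_mx mxblockEh (mxrow_recr (fun j => l j.+1)).
rewrite cast_row_mx !(mxcol_recd (fun j => l j.+1)) -mxblockEh.
rewrite mxblockEv (mxcol_recd (fun j => l j.+1)) -mxblockEv block_mxEh /=.
rewrite eqxx; congr (row_mx (col_mx _ _) (col_mx _ _)).
- by apply/matrixP => i j; rewrite [LHS]mxE ltn_eqF ?mxE ?ltn_ord.
- by apply/matrixP => i j; rewrite [LHS]mxE gtn_eqF ?mxE ?ltnS ?ltn_ord.
Qed.

(** The matrix inside [system_poly], over any field: complex numbers enter only when roots are
    taken. *)
Definition rosenbrock_mx {F : fieldType} {n r : nat} (A : 'M[F]_n)
    (B : 'M[F]_(n, r)) (C : 'M[F]_(r, n)) : 'M[{poly F}]_(n + r) :=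
  block_mx ('X%:M - map_mx polyC A) (- map_mx polyC B) (map_mx polyC C) 0.

Lemma rosenbrock_equiv (F : fieldType) (n r : nat) (A : 'M[F]_n)
    (B : 'M[F]_(n, r)) (C : 'M[F]_(r, n)) (N : 'M[F]_n) (M : 'M[F]_r) :
  N \in unitmx ->
  \det (rosenbrock_mx (N *m A *m invmx N) (N *m B *m M) (C *m invmx N)) =
  \det M *: \det (rosenbrock_mx A B C).
Proof.
move=> uN; pose P := map_mx polyC N; pose Q := map_mx polyC (invmx N).
have PQ : P *m Q = 1%:M by rewrite -map_mxM mulmxV // map_mx1.
have -> : rosenbrock_mx (N *m A *m invmx N) (N *m B *m M) (C *m invmx N) =
    block_mx P 0 0 1%:M *m rosenbrock_mx A B C *m
    block_mx Q 0 0 (map_mx polyC M).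
  rewrite /rosenbrock_mx !mulmx_block.
  rewrite !(mulmx0, mul0mx, mul1mx, add0r, addr0) !map_mxM mulmxBr mulmxBl.
  by rewrite mul_mx_scalar -scalemxAl PQ scalemx1 mulmxN mulNmx.
rewrite !det_mulmx !det_lblock det1 mulr1 (mulrC (\det P)) -!mulrA.
rewrite (mulrA (\det P)) -det_mulmx PQ det1 mul1r det_map_mx.
by rewrite mulrC mul_polyC.
Qed.

Lemma rosenbrock_char_poly (F : fieldType) (m r : nat) (S1 : 'M[F]_m)
    (S2 : 'M[F]_(m, r)) (F1 : 'M[F]_(r, m)) (F2 G Cl : 'M[F]_r) (Ci : 'M[F]_(r, m)) :
  G \in unitmx -> Cl \in unitmx ->
  exists2 c : F, c != 0 &
    \det (rosenbrock_mx (block_mx S1 S2 F1 F2) (col_mx 0 G) (row_mx Ci Cl)) =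
    c *: char_poly (S1 - S2 *m (invmx Cl *m Ci)).
Proof.
move=> uG uC; set K := invmx Cl *m Ci; set Z := S1 - _.
pose mp p q := @map_mx F {poly F} polyC p q.
(* J0 swaps the last two block columns; together with the column operations
   P it makes the matrix block triangular for the splitting (m + r) + r. *)
pose J0 : 'M[F]_(m + r + r) :=
  block_mx (block_mx 1%:M 0 0 0) (col_mx 0 1%:M) (row_mx 0 1%:M) 0.
(* Being an involution, [J0] has nonzero determinant; its sign need not be computed. *)
have JJ : J0 *m J0 = 1%:M.
  rewrite mulmx_block mulmx_block mul_col_row mul_mx_row mul_row_block.
  rewrite mul_block_col mul_row_col.
  rewrite !(mulmx0, mul0mx, mul1mx, add0r, addr0, col_mx0, row_mx0).
  by rewrite add_block_mx !(add0r, addr0) -!scalar_mx_block.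
have dJ : \det J0 != 0.
  have : J0 \in unitmx by case: (mulmx1_unit JJ).
  by rewrite unitmxE unitfE.
(* [W] is what subtracting the [Cl] column times [K] leaves in the row of [F1]. The input column,
   equal to [-G] in that row and zero elsewhere, then clears it through [L1], and ['X%:M - F2]
   through [L2]. *)
pose W : 'M[{poly F}]_(r, m) := - mp _ _ F1 - ('X%:M - mp _ _ F2) *m mp _ _ K.
pose L1 := mp _ _ (invmx G) *m W.
pose L2 := mp _ _ (invmx G) *m ('X%:M - mp _ _ F2).
pose P : 'M[{poly F}]_(m + r + r) :=
  block_mx (block_mx 1%:M 0 (- mp _ _ K) 1%:M) 0 (row_mx L1 L2) 1%:M.
have GK q (Y : 'M_(r, q)) : mp _ _ G *m (mp _ _ (invmx G) *m Y) = Y.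
  by rewrite mulmxA -map_mxM mulmxV // map_mx1 mul1mx.
have E : rosenbrock_mx (block_mx S1 S2 F1 F2) (col_mx 0 G) (row_mx Ci Cl) *m P
    *m mp _ _ J0 =
  block_mx (block_mx (char_poly_mx Z) 0 0 (- mp _ _ G))
           (col_mx (- mp _ _ S2) 0) 0 (mp _ _ Cl).
  rewrite /rosenbrock_mx /J0 /P /mp !(map_block_mx, map_col_mx, map_row_mx).
  rewrite !(map_mx0, map_mx1) -/(mp _ _).
  rewrite scalar_mx_block opp_block_mx add_block_mx opp_col_mx oppr0 !add0r.
  rewrite !mulmx_block !mul_row_block.
  rewrite !(mulmx0, mul0mx, mulmx1, mul1mx, add0r, addr0).
  rewrite mul_col_row !(mul0mx, mulNmx, mulmxN, mulmx0) GK GK.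
  rewrite add_block_mx !addr0 /W opprK !subrr.
  rewrite -!map_mxM {3 4}/K !(mulmxA Cl) mulmxV // mul1mx subrr -/K.
  rewrite mulmx_block mul_col_row mul_row_block mul_block_col mul_row_col.
  rewrite !(mulmx0, mul0mx, mulmx1, mul1mx, add0r, addr0).
  rewrite add_block_mx row_mx0 !(add0r, addr0) /char_poly_mx /Z.
  by rewrite map_mxB opprB addrA addrAC.
move: (congr1 determinant E).
rewrite !det_mulmx !det_ublock !det_lblock !det1 !mulr1 -/(char_poly Z).
rewrite -raddfN !det_map_mx => {}E.
(* [P] is unipotent, so its determinant is 1 although its entries involve ['X]; hence the factor is
   constant. *)
exists ((\det J0)^-1 * (\det (- G) * \det Cl)).
  rewrite !mulf_neq0 ?invr_eq0 //.
    by rewrite -unitfE -unitmxE -scaleN1r unitmxZ // unitrN1.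
  by rewrite -unitfE -unitmxE.
have dJp : (\det J0)%:P != 0 :> {poly F} by rewrite polyC_eq0.
apply: (mulIf dJp); rewrite E -mul_polyC !polyCM.
rewrite mulrC [RHS]mulrC !mulrA -polyCM mulfV // mul1r.
by rewrite mulrC mulrA.
Qed.

Lemma tail_mx_mul_eq (F : fieldType) (p q m : nat) (e : p = q)
    (X : 'M[F]_(q, m)) :
  tail_mx F p q *m X = castmx (esym e, erefl) X.
Proof.
case: q / e X => X; rewrite castmx_id.
suff -> : tail_mx F p p = 1%:M by rewrite mul1mx.
by apply/matrixP => i j; rewrite !mxE eqn_add2r eq_sym.
Qed.

(** With [X] the shift block, [Y] the tail block and [Z] the product [Cl^-1 Ci], this turns
    [[E; That]] into [S1 - S2 Cl^-1 Ci]. *)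
Lemma castmx_colB (F : fieldType) (p q r m s : nat) (e : (p + q = m)%N)
    (X : 'M[F]_(p, s)) (Y : 'M[F]_(q, r)) (Z : 'M[F]_(r, s)) :
  castmx (e, erefl) (col_mx X (- (Y *m Z))) =
  castmx (e, erefl) (col_mx X 0) - castmx (e, erefl) (col_mx 0 Y) *m Z.
Proof.
case: m / e; rewrite !castmx_id mul_col_mx mul0mx opp_col_mx add_col_mx.
by rewrite subr0 add0r.
Qed.

(** Bridges the size [n - r] of [zeros_mx] and the sum of block sizes where the elimination takes
    place. *)
Lemma char_poly_castmx (F : fieldType) (p q m : nat) (e1 : p = m) (e2 : q = m)
    (e : p = q) (X : 'M[F]_(p, q)) :
  char_poly (castmx (e1, e2) X) = char_poly (castmx (e, erefl) X).
Proof.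
by case: m / e2 e1 => e1; congr char_poly; apply: eq_castmx.
Qed.

(** For [l nu.-1 = r] the matrix [[O, I]] is the identity, so one formula covers both cases. *)
Lemma That_mxE (F : fieldType) (n r nu : nat) (l : nat -> nat)
    (d : block_dims n r nu l) (C : 'M[F]_(r, n)) (N : 'M[F]_n) :
  That_mx d C N =
  - (tail_mx F (l nu.-1) r *m (invmx (output_last d C N) *m output_init d C N)).
Proof.
rewrite /That_mx; case: eqP => [e | _]; last by rewrite mulmxA.
by rewrite tail_mx_mul_eq; apply/matrixP => i j; rewrite !(castmxE, mxE).
Qed.

Lemma det_rosenbrock_zeros_mx {F : fieldType} {n r nu : nat} {l : nat -> nat}
    {d : block_dims n r nu l} {A : 'M[F]_n} {B : 'M[F]_(n, r)}
    {C : 'M[F]_(r, n)} {N : 'M[F]_n} {M : 'M[F]_r} :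
  \det (C *m B) != 0 -> yokoyama_form d A B N M ->
  exists2 c : F, c != 0 &
    \det (rosenbrock_mx A B C) = c *: char_poly (zeros_mx d C N).
Proof.
have := block_dims_ge2 d; case: nu d => [|[|k]] // d _.
(* Replacing [r] and [n] by the expressions they equal makes the row casts of the Yokoyama form
   trivial. *)
have lr := block_dims_last d; case: r / lr A B C M d => A B C M d.
have e := block_dims_splitr d; case: n / e A B C N d => A B C N d.
move=> detCB [uN pM [Fnu NA [G [trigG diagG NB]]]].
rewrite /zeros_mx That_mxE /=.
have er : (\sum_(i < k.+1) l i.+1 = \sum_(i < k) l i.+1 + l k.+1)%N.
  by rewrite big_ord_recr.
pose Ci := output_init d C N; pose Cl := output_last d C N.
rewrite -/Ci -/Cl.
have CN : C *m invmx N = row_mx Ci Cl.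
  rewrite /Ci /Cl /output_init /output_last castmx_id.
  (* The bound proofs inside the ordinals are aligned with those produced by [mxrow_recr]. *)
  rewrite (bool_irrelevance (leq_pred k.+2) (leqnSn k.+1)).
  rewrite (bool_irrelevance (block_dims_pred_lt d) (ltnSn k.+1)).
  rewrite -(mxrow_recr (fun j => l j.+1) (block_dims_sum d)
                       (output_block d C N)).
  by rewrite submxrowK /output_mx castmx_comp castmx_id.
pose Sh := shift_mx F l k k.+1; pose T := tail_mx F (l k.+1) (l k.+2).
pose S1 := castmx (esym er, erefl) (col_mx Sh 0).
pose S2 := castmx (esym er, erefl) (col_mx 0 T).
have S12 :
    castmx (erefl, block_dims_sum d) (shift_mx F l k.+1 k.+2) = row_mx S1 S2.
  rewrite -cast_row_mx -block_mxEh -(shift_mx_recr _ _ _ er (block_dims_sum d)).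
  by rewrite castmx_comp; apply: eq_castmx.
pose Fn := castmx (erefl, block_dims_sum d) Fnu.
have {}NA : N *m A *m invmx N = block_mx S1 S2 (lsubmx Fn) (rsubmx Fn).
  by rewrite NA block_mxEv hsubmxK -S12 -cast_col_mx; apply: eq_castmx.
have {}NB : N *m B *m M = col_mx 0 G by rewrite NB castmx_id.
have dM : \det M != 0.
  have /is_perm_mxP[s ->] := pM.
  by rewrite det_perm signr_eq0.
have uG : G \in unitmx.
  by rewrite unitmxE det_trig // big1 // unitr1.
have uCl : Cl \in unitmx.
  have E : C *m B *m M = Cl *m G.
    rewrite -[RHS]add0r -(mulmx0 _ Ci) -mul_row_col -CN -NB.
    by rewrite -!mulmxA (mulKmx uN) !mulmxA.
  have : C *m B *m M \in unitmx.
    by rewrite unitmxE det_mulmx unitfE mulf_neq0.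
  by rewrite E unitmx_mul => /andP[].
have [c c_neq0] := rosenbrock_char_poly F _ _ S1 S2 (lsubmx Fn) (rsubmx Fn)
  G Cl Ci uG uCl.
rewrite -NA -NB -CN rosenbrock_equiv // => detE.
exists ((\det M)^-1 * c); first by rewrite mulf_neq0 ?invr_eq0.
rewrite -scalerA (char_poly_castmx _ _ _ _ _ _ (esym er)).
by rewrite castmx_colB -detE scalerA mulVf // scale1r.
Qed.

Theorem theorem7p6 (R : realType) (n r nu : nat)
    (A : 'M[R]_n) (B : 'M[R]_(n, r)) (C : 'M[R]_(r, n))
    (rankB : \rank B = r) (ctrAB : controllable A B)
    (indexAB : ctrl_index A B = nu) (nu_ge2 : (2 <= nu)%N)
    (detCB : \det (C *m B) != 0)
    (N : 'M[R]_n) (M : 'M[R]_r) :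
  let d := block_size_dims rankB ctrAB indexAB nu_ge2 in
  yokoyama_form d A B N M ->
  let Z := map_mx (real_complex R) (zeros_mx d C N) in
  forall z : complex R,
    (system_zero A B C z <-> eigenvalue Z z) /\
    mup z (system_polyC A B C) = mup z (char_poly Z).
Proof.
move=> d yok Z z.
have [c c_neq0 sysE] := det_rosenbrock_zeros_mx detCB yok.
have c_neq0' : real_complex R c != 0 by rewrite fmorph_eq0.
(* Proportionality by a nonzero constant, proved over the reals and mapped to the complex numbers,
   preserves roots and multiplicities. *)
have sysCE : system_polyC A B C = real_complex R c *: char_poly Z.
  by rewrite -map_char_poly -map_polyZ -sysE.
rewrite /system_zero sysCE eigenvalue_root_char rootZ //; split=> //.
by rewrite -mul_polyC mupMr // rootC.
Qed.
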